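(* Let $k$ be a positive integer and consider the $k$-th order system of two rational difference equations $$x_n=\frac{\alpha+\sum^{k}_{i=1}\beta_{i}x_{n-i} + \sum^{k}_{i=1}\gamma_{i}y_{n-i}}{A+\sum^{k}_{j=1}B_{j}x_{n-j} + \sum^{k}_{j=1}C_{j}y_{n-j}},\qquad y_n=\frac{p+\sum^{k}_{i=1}\delta_{i}x_{n-i} + \sum^{k}_{i=1}\epsilon_{i}y_{n-i}}{q+\sum^{k}_{j=1}D_{j}x_{n-j} + \sum^{k}_{j=1}E_{j}y_{n-j}},\qquad n\in\mathbb{N},$$ with non-negative real parameters and non-negative initial conditions. Suppose that $A=0$, $\alpha=0$, $I_\beta\subseteq I_B$, and $I_\gamma\subseteq I_C$. Then there exist $M>0$ and $N\in\mathbb{N}$ such that every solution (from any non-negative initial conditions) satisfies $x_n\le M$ for all $n>N$.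
   Context: $\mathbb{N}=\{1,2,\dots\}$. Initial conditions are $x_{1-k},\dots,x_0,y_{1-k},\dots,y_0\ge 0$; a solution is a pair of sequences generated by the system from non-negative initial conditions for which all denominators are positive for every $n\in\mathbb{N}$. Index sets in $\{1,\dots,k\}$: $I_\beta=\{i:\beta_i>0\}$, $I_\gamma=\{i:\gamma_i>0\}$, $I_B=\{j:B_j>0\}$, $I_C=\{j:C_j>0\}$. *)

(* Defs.v *)
From HB Require Import structures.
From mathcomp Require Import all_boot all_order all_algebra.
From mathcomp Require Import reals.
Set Implicit Arguments.
Unset Strict Implicit.
Unset Printing Implicit Defensive.
Import Order.TTheory GRing.Theory Num.Theory.
Local Open Scope ring_scope.

(* Coefficient families indexed by {1, ..., k} are functions on 'I_k, the
   ordinal i standing for the index i + 1.  Sequences are functions on int, of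
   which only the values at indices m >= 1 - k are ever used. *)

(* c + \sum_{i=1}^k a_i x_{n-i} + \sum_{i=1}^k b_i y_{n-i} *)
Definition affine_form (R : realType) (k : nat) (c : R) (a b : 'I_k -> R)
    (x y : int -> R) (n : int) : R :=
  c + \sum_(i < k) a i * x (n - i.+1%:Z) + \sum_(i < k) b i * y (n - i.+1%:Z).

Definition index_set (R : realType) (k : nat) (a : 'I_k -> R) : {set 'I_k} :=
  [set i | 0 < a i].

(* Division is total in MathComp (u / 0 = 0), so positivity of both
   denominators at every n >= 1 is an explicit requirement. *)
Definition is_solution (R : realType) (k : nat)
    (alpha : R) (beta gamma : 'I_k -> R) (A : R) (B C : 'I_k -> R)
    (p : R) (delta epsilon : 'I_k -> R) (q : R) (D E : 'I_k -> R)
    (x y : int -> R) : Prop :=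
  (forall m : int, 1 - k%:Z <= m <= 0 -> 0 <= x m /\ 0 <= y m) /\
  (forall n : nat, (1 <= n)%N ->
    [/\ 0 < affine_form A B C x y n%:Z,
        0 < affine_form q D E x y n%:Z,
        x n%:Z = affine_form alpha beta gamma x y n%:Z /
                 affine_form A B C x y n%:Z
      & y n%:Z = affine_form p delta epsilon x y n%:Z /
                 affine_form q D E x y n%:Z]).

(* Main.v *)
(* Since the support of every coefficient of the numerator of x_n lies in the
   support of the corresponding coefficient of the denominator, and neither has
   a constant term, the numerator is termwise at most M times the denominator
   with M = 1 + \sum beta_i / B_i + \sum gamma_i / C_i. *)
Require Import Defs.
From HB Require Import structures.
From mathcomp Require Import all_boot all_order all_algebra.
From mathcomp Require Import reals.
From mathcomp Require Import zify lra.
Set Implicit Arguments.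
Unset Strict Implicit.
Unset Printing Implicit Defensive.
Import Order.TTheory GRing.Theory Num.Theory.
Local Open Scope ring_scope.

Lemma affine_form_ge0 (R : realType) (k : nat) (c : R) (a b : 'I_k -> R)
    (x y : int -> R) (n : int) :
  0 <= c -> (forall i, 0 <= a i) -> (forall i, 0 <= b i) ->
  (forall i : 'I_k, 0 <= x (n - i.+1%:Z) /\ 0 <= y (n - i.+1%:Z)) ->
  0 <= affine_form c a b x y n.
Proof.
move=> c0 a0 b0 xy0; rewrite /affine_form.
by rewrite !addr_ge0 ?sumr_ge0 // => i _; rewrite mulr_ge0 //; case: (xy0 i).
Qed.

(* Indices with [b i = 0] contribute [a i / 0 = 0] to the sum. *)
Lemma coef_le_sum_ratio (R : realType) (k : nat) (a b : 'I_k -> R) :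
  (forall i, 0 <= a i) -> (forall i, 0 <= b i) ->
  index_set a \subset index_set b ->
  forall i, a i <= (\sum_j a j / b j) * b i.
Proof.
move=> a0 b0 /subsetP sab i.
have r0 j : 0 <= a j / b j by rewrite divr_ge0.
have [ai0|ai_le0] := ltP 0 (a i); last first.
  by rewrite (le_trans ai_le0) // mulr_ge0 // sumr_ge0.
(* The support inclusion makes division by [b i] legitimate here; what remains is that the single
   ratio [a i / b i] is at most a sum of nonnegative ratios containing it. *)
have bi0 : 0 < b i by have := sab i; rewrite !inE; apply.
by rewrite -ler_pdivrMr // (bigD1 i) //= lerDl sumr_ge0.
Qed.

(** With both constant terms zero, coefficientwise domination suffices: multiplying by nonnegative
    past values preserves each inequality. *)
Lemma affine_form_le (R : realType) (k : nat) (M : R) (a b a' b' : 'I_k -> R)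
    (x y : int -> R) (n : int) :
  (forall i, a i <= M * a' i) -> (forall i, b i <= M * b' i) ->
  (forall i : 'I_k, 0 <= x (n - i.+1%:Z) /\ 0 <= y (n - i.+1%:Z)) ->
  affine_form 0 a b x y n <= M * affine_form 0 a' b' x y n.
Proof.
move=> aM bM xy0; rewrite /affine_form !add0r mulrDr !mulr_sumr.
by rewrite lerD // ler_sum // => i _; rewrite mulrA ler_wpM2r //; case: (xy0 i).
Qed.

(** Signs propagate from the initial window: each new value is a nonnegative numerator over a
    denominator that [is_solution] makes positive. *)
Lemma solution_ge0 (R : realType) (k : nat)
    (alpha : R) (beta gamma : 'I_k -> R) (A : R) (B C : 'I_k -> R)
    (p : R) (delta epsilon : 'I_k -> R) (q : R) (D E : 'I_k -> R)
    (x y : int -> R) :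
  0 <= alpha -> (forall i, 0 <= beta i) -> (forall i, 0 <= gamma i) ->
  0 <= p -> (forall i, 0 <= delta i) -> (forall i, 0 <= epsilon i) ->
  is_solution alpha beta gamma A B C p delta epsilon q D E x y ->
  forall m : int, 1 - k%:Z <= m -> 0 <= x m /\ 0 <= y m.
Proof.
move=> alpha0 beta0 gamma0 p0 delta0 epsilon0 [init rec].
(* Bounding [m] by a natural number [n] turns the claim into an induction whose hypothesis covers
   all [k] earlier values at once. *)
suff xy0 (n : nat) (m : int) : 1 - k%:Z <= m <= n%:Z -> 0 <= x m /\ 0 <= y m.
  by move=> m km; apply: (xy0 `|m|%N); lia.
elim: n m => [|n IHn] m mn; first exact: init.
have [m_le|m_gt] := leP m n%:Z; first by apply: IHn; lia.
have -> : m = n.+1%:Z by lia.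
have prev (i : 'I_k) :
    0 <= x (n.+1%:Z - i.+1%:Z) /\ 0 <= y (n.+1%:Z - i.+1%:Z).
  by apply: IHn; have := ltn_ord i; lia.
have [//|dx dy -> ->] := rec n.+1.
by split; (apply: divr_ge0; [exact: affine_form_ge0 | exact: ltW]).
Qed.

Theorem theorem8 (R : realType) (k : nat) (k_gt0 : (0 < k)%N)
    (alpha : R) (beta gamma : 'I_k -> R) (A : R) (B C : 'I_k -> R)
    (p : R) (delta epsilon : 'I_k -> R) (q : R) (D E : 'I_k -> R)
    (alpha_ge0 : 0 <= alpha)
    (beta_ge0 : forall i, 0 <= beta i) (gamma_ge0 : forall i, 0 <= gamma i)
    (A_ge0 : 0 <= A)
    (B_ge0 : forall j, 0 <= B j) (C_ge0 : forall j, 0 <= C j)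
    (p_ge0 : 0 <= p)
    (delta_ge0 : forall i, 0 <= delta i)
    (epsilon_ge0 : forall i, 0 <= epsilon i)
    (q_ge0 : 0 <= q)
    (D_ge0 : forall j, 0 <= D j) (E_ge0 : forall j, 0 <= E j)
    (A_eq0 : A = 0) (alpha_eq0 : alpha = 0)
    (beta_sub_B : index_set beta \subset index_set B)
    (gamma_sub_C : index_set gamma \subset index_set C) :
  exists (M : R) (N : nat), 0 < M /\ (1 <= N)%N /\
    forall x y : int -> R,
      is_solution alpha beta gamma A B C p delta epsilon q D E x y ->
      forall n : nat, (N < n)%N -> x n%:Z <= M.
Proof.
subst A alpha.
pose rx := \sum_j beta j / B j; pose ry := \sum_j gamma j / C j.
have rx0 : 0 <= rx by rewrite sumr_ge0 // => j _; rewrite divr_ge0.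
have ry0 : 0 <= ry by rewrite sumr_ge0 // => j _; rewrite divr_ge0.
(* The summand 1 keeps the bound positive even if [rx] and [ry] both vanish. The estimate holds from
   index 1 on, so the least admissible [N] will do. *)
exists (1 + rx + ry), 1%N; split; first by rewrite -addrA ltr_pwDl ?addr_ge0.
split=> // x y sol n n_gt1.
have [|dx _ -> _] := sol.2 n; first exact: ltnW.
rewrite ler_pdivrMr //; apply: affine_form_le => i.
- apply: le_trans (coef_le_sum_ratio beta_ge0 B_ge0 beta_sub_B i) _.
  by rewrite ler_wpM2r // -/rx; lra.
- apply: le_trans (coef_le_sum_ratio gamma_ge0 C_ge0 gamma_sub_C i) _.
  by rewrite ler_wpM2r // -/ry; lra.
- by apply: (solution_ge0 _ _ _ _ _ _ sol) => //; have := ltn_ord i; lia.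
Qed.
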